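(* Let $K$ be a field and $E$ a directed graph (of arbitrary cardinality). Then $L_K(E)$ is a simple ring if and only if $E$ satisfies Condition (L) and the only saturated hereditary subsets of $E^0$ are $\varnothing$ and $E^0$.
   Context: A (directed) graph $E=(E^0,E^1,r,s)$ consists of two disjoint sets $E^0$ (vertices), $E^1$ (edges) and maps $r,s:E^1\to E^0$ (range and source). A vertex $v$ is a sink if $s^{-1}(v)=\varnothing$, and an infinite emitter if $s^{-1}(v)$ is infinite. The double $\widehat E$ of $E$ has $\widehat E^0=E^0$ and $\widehat E^1=E^1\sqcup\{e^*\mid e\in E^1\}$, with $r(e^* )=s(e)$, $s(e^* )=r(e)$. Paths are written left to right: $e_1e_2\cdots e_n$ with $r(e_i)=s(e_{i+1})$; there is also a path $v$ of length zero at each vertex $v$. The path algebra $K\widehat E$ is the $K$-vector space with basis all paths in $\widehat E$, with multiplication given by concatenation when range and source match, and $0$ otherwise. The Leavitt path algebra $L_K(E)$ is the (not necessarily unital) quotient of $K\widehat E$ by the ideal generated by: $e^*e-r(e)$ for all $e\in E^1$; $e^*f$ for all distinct $e,f\in E^1$; and $v-\sum_{e\in E^1,\,s(e)=v}ee^*$ for every $v\in E^0$ which is neither a sink nor an infinite emitter. A path $p=e_1e_2\cdots e_n$ ($n\ge1$) in $E$ is closed if $r(e_n)=s(e_1)$; a closed path $p$ is simple if $s(e_i)\ne s(e_1)$ for all $i=2,\dots,n$. An exit for $p$ is an edge $e\in E^1$ such that for some $i\in\{1,\dots,n\}$, $s(e)=s(e_i)$ but $e\ne e_i$. The graph $E$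 satisfies Condition (L) if every simple closed path in $E$ has an exit. A subset $H\subseteq E^0$ is hereditary if $e\in E^1$ and $s(e)\in H$ imply $r(e)\in H$. It is saturated if each vertex $v\in E^0$ which is neither a sink nor an infinite emitter, and which satisfies $r(e)\in H$ for all $e\in s^{-1}(v)$, lies in $H$. A ring $R$ is simple here if its only two-sided ideals are $0$ and $R$ (with this convention the zero ring, which occurs only for the empty graph, is not excluded). *)

(* Defs.v *)
From HB Require Import structures.
From mathcomp Require Import all_boot all_algebra finmap.
From mathcomp Require Import boolp classical_sets cardinality fsbigop.
From mathcomp.multinomials Require Import monalg.

Set Implicit Arguments.
Unset Strict Implicit.
Unset Printing Implicit Defensive.

Import GRing.Theory.
Local Open Scope classical_set_scope.
Local Open Scope ring_scope.
Local Open Scope quotient_scope.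

Reserved Notation "x ** y" (at level 40, left associativity).

(* Rings are not assumed to have an identity element: L_K(E) is unital only
   when E has finitely many vertices.  The zero ring is allowed. *)
HB.mixin Record Zmodule_isNURing R of GRing.Zmodule R := {
  numul : R -> R -> R;
  numulA : associative numul;
  numulDl : left_distributive numul +%R;
  numulDr : right_distributive numul +%R
}.

#[short(type="nuRingType")]
HB.structure Definition NURing := {R of GRing.Zmodule R & Zmodule_isNURing R}.

Notation "x ** y" := (numul x y) : ring_scope.

Section NURingTheory.
Variable R : nuRingType.
Implicit Types x y z : R.

Lemma numul0r x : 0 ** x = 0.
Proof. by apply: (addIr (0 ** x)); rewrite -numulDl !add0r. Qed.

Lemma numulr0 x : x ** 0 = 0.
Proof. by apply: (addIr (x ** 0)); rewrite -numulDr !add0r. Qed.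

Lemma numulNr x y : (- x) ** y = - (x ** y).
Proof. by apply: (addIr (x ** y)); rewrite -numulDl !addNr numul0r. Qed.

Lemma numulrN x y : x ** (- y) = - (x ** y).
Proof. by apply: (addIr (x ** y)); rewrite -numulDr !addNr numulr0. Qed.

Lemma numulBl x y z : (x - y) ** z = x ** z - y ** z.
Proof. by rewrite numulDl numulNr. Qed.

Lemma numulBr x y z : z ** (x - y) = z ** x - z ** y.
Proof. by rewrite numulDr numulrN. Qed.
End NURingTheory.

Definition ideal_closed (R : nuRingType) (I : set R) :=
  [/\ I 0,
      forall x y, I x -> I y -> I (x - y),
      forall a x, I x -> I (a ** x) &
      forall a x, I x -> I (x ** a)].

Definition simple_ring (R : nuRingType) :=
  forall I : set R, ideal_closed I -> I = [set 0] \/ I = setT.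

Record ideal (R : nuRingType) := Ideal {
  ideal_set : set R;
  idealP : ideal_closed ideal_set
}.

Lemma smallest_ideal_closed (R : nuRingType) (G : set R) :
  ideal_closed (smallest (@ideal_closed R) G).
Proof.
split=> [I [[]] // | x y Ix Iy I [HI GI] | a x Ix I [HI GI] | a x Ix I [HI GI]].
- by case: (HI) => _ + _ _; apply; [apply: Ix | apply: Iy].
- by case: (HI) => _ _ + _; apply; apply: Ix.
- by case: (HI) => _ _ _; apply; apply: Ix.
Qed.

Definition ideal_gen (R : nuRingType) (G : set R) : ideal R :=
  Ideal (smallest_ideal_closed G).

Section NUQuotient.
Variables (R : nuRingType) (I : ideal R).

Definition ideal_pred : {pred R} := fun x => `[< ideal_set I x >].

Lemma ideal_zmod_closed : zmod_closed ideal_pred.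
Proof.
have [I0 IB _ _] := idealP I.
split=> [|x y /asboolP Ix /asboolP Iy]; apply/asboolP => //; exact: IB.
Qed.

HB.instance Definition _ := GRing.isZmodClosed.Build R ideal_pred
  ideal_zmod_closed.

Definition nuquot : Type := {ideal_quot ideal_pred}.

HB.instance Definition _ := ZmodQuotient.on nuquot.

Definition nuquot_mul (x y : nuquot) : nuquot :=
  \pi_nuquot (repr x ** repr y).

Lemma nuquot_piP (x y : R) :
  \pi_nuquot x = \pi_nuquot y <-> ideal_set I (x - y).
Proof.
have e : (x - y \in ideal_pred) = (\pi_nuquot x == \pi_nuquot y).
  exact: Quotient.idealrBE.
split=> [xy|Ixy]; first by apply/asboolP; move: e; rewrite xy eqxx.
by apply/eqP; rewrite -e; apply/asboolP.
Qed.

Lemma nuquot_piM (x y : R) :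
  \pi_nuquot (x ** y) = nuquot_mul (\pi x) (\pi y).
Proof.
apply/nuquot_piP.
have [I0 IB Il Ir] := idealP I.
set x' := repr _; set y' := repr _.
have Ix : ideal_set I (x - x') by apply/nuquot_piP; rewrite reprK.
have Iy : ideal_set I (y' - y) by apply/nuquot_piP; rewrite reprK.
have -> : x ** y - x' ** y' = (x - x') ** y - x' ** (y' - y).
  by rewrite numulBl numulBr opprB addrA subrK.
exact: IB (Ir _ _ Ix) (Il _ _ Iy).
Qed.

Lemma nuquot_mulA : associative nuquot_mul.
Proof.
elim/quotW=> x; elim/quotW=> y; elim/quotW=> z.
rewrite -(nuquot_piM x y) -(nuquot_piM y z) -(nuquot_piM x) numulA.
exact: nuquot_piM.
Qed.

Lemma nuquot_mulDl : left_distributive nuquot_mul +%R.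
Proof.
elim/quotW=> x; elim/quotW=> y; elim/quotW=> z.
rewrite -(nuquot_piM x z) -(nuquot_piM y z) -!raddfD -numulDl.
by rewrite -nuquot_piM.
Qed.

Lemma nuquot_mulDr : right_distributive nuquot_mul +%R.
Proof.
elim/quotW=> x; elim/quotW=> y; elim/quotW=> z.
rewrite -(nuquot_piM x y) -(nuquot_piM x z) -!raddfD -numulDr.
by rewrite -nuquot_piM.
Qed.

HB.instance Definition _ := Zmodule_isNURing.Build nuquot
  nuquot_mulA nuquot_mulDl nuquot_mulDr.
End NUQuotient.

Record graph := Graph {
  vertex : Type;
  edge : Type;
  src : edge -> vertex;
  rng : edge -> vertex
}.

HB.instance Definition _ E := gen_eqMixin (vertex E).
HB.instance Definition _ E := gen_choiceMixin (vertex E).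
HB.instance Definition _ E := gen_eqMixin (edge E).
HB.instance Definition _ E := gen_choiceMixin (edge E).

Section Paths.
Variable E : graph.
Implicit Types (v : vertex E) (e : edge E) (s : seq (edge E)).

Fixpoint is_walk v s : bool :=
  if s is e :: s' then (src e == v) && is_walk (rng e) s' else true.

Definition walk_end v s : vertex E := last v (map (@rng E) s).

(* The initial vertex is recorded so that there is one path of length zero
   at each vertex. *)
Record gpath := GPath {
  gpath_val : vertex E * seq (edge E);
  gpathP : is_walk gpath_val.1 gpath_val.2
}.

HB.instance Definition _ := [isSub for gpath_val].
HB.instance Definition _ := [Choice of gpath by <:].

Definition psrc (p : gpath) : vertex E := (gpath_val p).1.
Definition pedges (p : gpath) : seq (edge E) := (gpath_val p).2.
Definition prng (p : gpath) : vertex E := walk_end (psrc p) (pedges p).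

Definition vertex_path v : gpath := @GPath (v, [::]) isT.

Lemma edge_pathP e : is_walk (src e) [:: e].
Proof. by rewrite /= eqxx. Qed.

Definition edge_path e : gpath := @GPath (src e, [:: e]) (edge_pathP e).

Lemma is_walk_cat v s1 s2 :
  is_walk v (s1 ++ s2) = is_walk v s1 && is_walk (walk_end v s1) s2.
Proof. by elim: s1 v => //= e s1 IH v; rewrite IH andbA. Qed.

Lemma path_catP (p q : gpath) : prng p = psrc q ->
  is_walk (psrc p) (pedges p ++ pedges q).
Proof.
by move=> pq; rewrite is_walk_cat (gpathP p) /= -/(prng p) pq (gpathP q).
Qed.

Definition path_cat (p q : gpath) (pq : prng p = psrc q) : gpath :=
  @GPath (psrc p, pedges p ++ pedges q) (path_catP pq).

Lemma prng_cat (p q : gpath) (pq : prng p = psrc q) :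
  prng (path_cat pq) = prng q.
Proof.
change (last (psrc p) (map (@rng E) (pedges p ++ pedges q)) = prng q).
by rewrite map_cat last_cat -/(walk_end (psrc p) (pedges p)) -/(prng p) pq.
Qed.

Definition closed_path (p : gpath) := pedges p <> [::] /\ prng p = psrc p.

Definition simple_closed_path (p : gpath) :=
  closed_path p /\ forall e, e \in behead (pedges p) -> src e <> psrc p.

Definition is_exit (p : gpath) (f : edge E) :=
  exists2 e, e \in pedges p & src f = src e /\ f <> e.

Definition condition_L :=
  forall p : gpath, simple_closed_path p -> exists f, is_exit p f.

Definition out_edges v : set (edge E) := [set e | src e = v].
Definition sink v := out_edges v = set0.
Definition infinite_emitter v := infinite_set (out_edges v).
Definition regular v := ~ sink v /\ ~ infinite_emitter v.

Definition hereditary (H : set (vertex E)) :=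
  forall e, H (src e) -> H (rng e).

Definition saturated (H : set (vertex E)) :=
  forall v, regular v -> (forall e, src e = v -> H (rng e)) -> H v.

End Paths.

Section PathAlgebra.
Variables (K : fieldType) (E : graph).

Definition path_alg : Type := {malg K[gpath E]}.

HB.instance Definition _ := GRing.Lmodule.on path_alg.

Definition path_prod (p q : gpath E) : path_alg :=
  if prng p =P psrc q is ReflectT pq then << path_cat pq >> else 0.

Definition path_alg_mul (x y : path_alg) : path_alg :=
  \sum_(p <- msupp x) \sum_(q <- msupp y) (x@_p * y@_q) *: path_prod p q.

Lemma path_prodE (p q : gpath E) (pq : prng p = psrc q) :
  path_prod p q = << path_cat pq >>.
Proof.
rewrite /path_prod; case: eqP => // pq'.
by congr (<< _ >>); apply: val_inj.
Qed.

Lemma path_prod0 (p q : gpath E) : prng p <> psrc q -> path_prod p q = 0.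
Proof. by rewrite /path_prod; case: eqP. Qed.

Lemma path_alg_mulEw (D D' : {fset gpath E}) (x y : path_alg) :
  (msupp x `<=` D)%fset -> (msupp y `<=` D')%fset ->
  path_alg_mul x y =
  \sum_(p <- D) \sum_(q <- D') (x@_p * y@_q) *: path_prod p q.
Proof.
move=> xD yD'; rewrite /path_alg_mul (big_fset_incl _ xD) /=; last first.
  by move=> p _ /mcoeff_outdom xp; rewrite big1 // => q _; rewrite xp mul0r scale0r.
apply: eq_bigr => p _; apply: big_fset_incl => // q _ /mcoeff_outdom yq.
by rewrite yq mulr0 scale0r.
Qed.

Lemma path_alg_mulDl : left_distributive path_alg_mul +%R.
Proof.
move=> x y z; set D := (msupp x `|` msupp y)%fset.
have xD : (msupp x `<=` D)%fset by apply: fsubsetUl.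
have yD : (msupp y `<=` D)%fset by apply: fsubsetUr.
rewrite (path_alg_mulEw (msuppD_le x y) (fsubset_refl _)).
rewrite (path_alg_mulEw xD (fsubset_refl _)).
rewrite (path_alg_mulEw yD (fsubset_refl _)) -big_split /=.
apply: eq_bigr => p _; rewrite -big_split /=; apply: eq_bigr => q _.
by rewrite mcoeffD mulrDl scalerDl.
Qed.

Lemma path_alg_mulDr : right_distributive path_alg_mul +%R.
Proof.
move=> z x y; set D := (msupp x `|` msupp y)%fset.
have xD : (msupp x `<=` D)%fset by apply: fsubsetUl.
have yD : (msupp y `<=` D)%fset by apply: fsubsetUr.
rewrite (path_alg_mulEw (fsubset_refl _) (msuppD_le x y)).
rewrite (path_alg_mulEw (fsubset_refl _) xD).
rewrite (path_alg_mulEw (fsubset_refl _) yD) -big_split /=.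
apply: eq_bigr => p _; rewrite -big_split /=; apply: eq_bigr => q _.
by rewrite mcoeffD mulrDr scalerDl.
Qed.

Lemma path_alg_mulUU (a b : K) (p q : gpath E) :
  path_alg_mul << a *g p >> << b *g q >> = (a * b) *: path_prod p q.
Proof.
by rewrite (path_alg_mulEw msuppU_le msuppU_le) !big_seq_fset1 !mcoeffUU.
Qed.

Lemma path_algZU (c a : K) (p : gpath E) :
  c *: << a *g p >> = << c * a *g p >> :> path_alg.
Proof. by apply/malgP=> k; rewrite mcoeffZ !mcoeffU mulrnAr. Qed.

Lemma path_alg_mul0x x : path_alg_mul 0 x = 0.
Proof. by rewrite /path_alg_mul msupp0 big_seq_fset0. Qed.

Lemma path_alg_mulx0 x : path_alg_mul x 0 = 0.
Proof.
by rewrite /path_alg_mul msupp0 big1 // => p _; rewrite big_seq_fset0.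
Qed.

Lemma path_alg_ind (P : path_alg -> Prop) :
  P 0 -> (forall x y, P x -> P y -> P (x + y)) ->
  (forall a p, P << a *g p >>) -> forall x, P x.
Proof. by move=> P0 PD PU x; rewrite [x]monalgE; apply: big_ind. Qed.

Lemma path_alg_mulA_basis (a b c : K) (p q r : gpath E) :
  path_alg_mul << a *g p >> (path_alg_mul << b *g q >> << c *g r >>) =
  path_alg_mul (path_alg_mul << a *g p >> << b *g q >>) << c *g r >>.
Proof.
rewrite !path_alg_mulUU.
have [pq|npq] := eqVneq (prng p) (psrc q); last first.
  rewrite (path_prod0 (elimN eqP npq)) scaler0 path_alg_mul0x.
  have [qr|nqr] := eqVneq (prng q) (psrc r); last first.
    by rewrite (path_prod0 (elimN eqP nqr)) scaler0 path_alg_mulx0.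
  rewrite (path_prodE qr) path_algZU path_alg_mulUU.
  by rewrite (path_prod0 (elimN eqP _)) ?scaler0.
rewrite (path_prodE pq) path_algZU path_alg_mulUU.
have [qr|nqr] := eqVneq (prng q) (psrc r); last first.
  rewrite (path_prod0 (elimN eqP nqr)) scaler0 path_alg_mulx0.
  by rewrite (path_prod0 (elimN eqP _)) ?scaler0 // prng_cat.
rewrite (path_prodE qr) path_algZU path_alg_mulUU.
have pqr : prng p = psrc (path_cat qr) by [].
have pqr' : prng (path_cat pq) = psrc r by rewrite prng_cat.
rewrite (path_prodE pqr) (path_prodE pqr') !mulr1 mulrA.
by congr (_ *: << _ >>); apply: val_inj; rewrite /= /pedges /= catA.
Qed.

Lemma path_alg_mulA : associative path_alg_mul.
Proof.
elim/path_alg_ind=> [|x x' IHx IHx'|a p] y z; first by rewrite !path_alg_mul0x.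
  by rewrite !path_alg_mulDl IHx IHx'.
elim/path_alg_ind: y => [|y y' IHy IHy'|b q].
- by rewrite path_alg_mul0x !path_alg_mulx0 path_alg_mul0x.
- by rewrite path_alg_mulDl !path_alg_mulDr path_alg_mulDl IHy IHy'.
elim/path_alg_ind: z => [|z z' IHz IHz'|c r]; first by rewrite !path_alg_mulx0.
  by rewrite !path_alg_mulDr IHz IHz'.
exact: path_alg_mulA_basis.
Qed.

HB.instance Definition _ := Zmodule_isNURing.Build path_alg
  path_alg_mulA path_alg_mulDl path_alg_mulDr.

End PathAlgebra.

Definition double_graph (E : graph) : graph := {|
  vertex := vertex E;
  edge := edge E + edge E;
  src := fun x => match x with inl e => src e | inr e => rng e end;
  rng := fun x => match x with inl e => rng e | inr e => src e end
|}.

Section Leavitt.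
Variables (K : fieldType) (E : graph).

Local Notation A := (path_alg K (double_graph E)).

Definition gen_vertex (v : vertex E) : A :=
  << vertex_path (v : vertex (double_graph E)) >>.
Definition gen_edge (e : edge E) : A :=
  << edge_path (inl e : edge (double_graph E)) >>.
Definition gen_ghost (e : edge E) : A :=
  << edge_path (inr e : edge (double_graph E)) >>.

Inductive leavitt_rel : set A :=
| LeavittCK1 (e : edge E) :
    leavitt_rel (gen_ghost e ** gen_edge e - gen_vertex (rng e))
| LeavittCK1_distinct (e f : edge E) : e <> f ->
    leavitt_rel (gen_ghost e ** gen_edge f)
| LeavittCK2 (v : vertex E) : regular v ->
    leavitt_rel
      (gen_vertex v - \sum_(e \in out_edges v) gen_edge e ** gen_ghost e).

(* A ring ideal of a path algebra is automatically a K-subspace, because every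
   element x satisfies x = u ** x for a finite sum u of vertices. *)
Definition leavitt : nuRingType := nuquot (ideal_gen leavitt_rel).
End Leavitt.

(* Main.v *)
(* Simplicity implies both conditions: boundary paths (infinite paths, and
   finite paths ending at a singular vertex) that avoid a saturated hereditary
   set H carry a representation of L_K(E), whose kernel contains exactly the
   vertices of H.  If a closed path p based at v has no exit, then p^oo is the
   only boundary path starting at v, so v - p acts as zero; it acts nontrivially
   once boundary paths carry an integer that every edge shifts by one.

   Conversely, let J be an ideal without vertices.  A nonzero combination of
   real paths in J can be compressed by a shortest path occurring in it to some
   a v + (closed paths at v), a != 0, and Condition (L) then removes the closed
   paths one by one, leaving a vertex in J.  An element x of J with ghost edges
   reduces to this case, since x e has smaller ghost degree for every edge e and
   therefore vanishes by induction.  So J = 0.  An ideal that does contain a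
   vertex contains a nonempty saturated hereditary set of them, hence all. *)

Require Import Defs.
From mathcomp Require Import all_boot all_order all_algebra finmap.
From mathcomp Require Import boolp classical_sets cardinality fsbigop.
From mathcomp.multinomials Require Import monalg.

Set Implicit Arguments.
Unset Strict Implicit.
Unset Printing Implicit Defensive.

Import Order.TTheory GRing.Theory Num.Theory.
Local Open Scope classical_set_scope.
Local Open Scope ring_scope.
Local Open Scope quotient_scope.

(** * Lists and finite sums *)

Lemma mem_split (T : eqType) (x : T) (s : seq T) :
  x \in s -> exists a b, s = a ++ x :: b.
Proof. by case/path.splitPr=> a b; exists a, b. Qed.

Lemma exists_minimum (T : eqType) (f : T -> nat) (s : seq T) : s <> [::] ->
  exists2 x, x \in s & forall y, y \in s -> (f x <= f y)%N.
Proof.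
elim: s => // x [|y s] IH _.
  by exists x => [|z]; rewrite inE ?eqxx // => /eqP ->.
have [//|z zs zmin] := IH; have [le_xz|lt_zx] := leqP (f x) (f z).
  exists x => [|t]; first exact: mem_head.
  by rewrite inE => /predU1P [->//|/zmin]; apply: leq_trans.
exists z => [|t]; first by rewrite inE zs orbT.
by rewrite inE => /predU1P [->|/zmin //]; apply: ltnW.
Qed.

Section NURingSums.
Variables (R : nuRingType) (I : Type) (r : seq I) (P : pred I) (F : I -> R).
Implicit Type x : R.

Lemma numul_suml x :
  (\sum_(i <- r | P i) F i) ** x = \sum_(i <- r | P i) F i ** x.
Proof.
by apply: (big_morph (fun y => y ** x)) => [y z|]; rewrite ?numulDl ?numul0r.
Qed.

Lemma numul_sumr x :
  x ** (\sum_(i <- r | P i) F i) = \sum_(i <- r | P i) x ** F i.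
Proof.
by apply: (big_morph (fun y => x ** y)) => [y z|]; rewrite ?numulDr ?numulr0.
Qed.

End NURingSums.

(** * Closed walks and exits *)

Section Walks.
Variable G : graph.
Implicit Types (v : vertex G) (s : seq (edge G)).

Lemma walk_end_cat v s1 s2 :
  walk_end v (s1 ++ s2) = walk_end (walk_end v s1) s2.
Proof. by rewrite /walk_end map_cat last_cat. Qed.

(** Condition (L) speaks of simple closed paths only. A walk with a later edge leaving [v] is cut
    there: the prefix is a shorter closed walk at [v], and its exit serves for [s]. *)
Lemma exit_of_closed_walk v s : condition_L G ->
  s <> [::] -> is_walk v s -> walk_end v s = v ->
  exists s1 e s2 f, [/\ s = s1 ++ e :: s2, src f = src e & f <> e].
Proof.
move=> GL; have [n] := ubnP (size s); elim: n s => // n IH s le_sn s0 sw se.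
have [[h [a [e [b [es ev]]]]]|nret] := pselect (exists h a e b,
    s = (h :: a) ++ e :: b /\ src e = v).
  have sw' := sw; rewrite es is_walk_cat in sw'; case/andP: sw' => haw /=.
  case/andP=> /eqP eh _.
  have [||//||] := IH (h :: a); rewrite -?eh //.
    move: le_sn; rewrite es size_cat /= addnS ltnS => /(leq_ltn_trans _); apply.
    by rewrite ltnS leq_addr.
  move=> s1 [e1 [s2 [f [hae fe fne]]]]; exists s1, e1, (s2 ++ e :: b), f.
  by rewrite es hae -catA.
have GLs : simple_closed_path (@GPath G (v, s) sw).
  split=> // e; rewrite /pedges /psrc /=.
  case: (s) nret => [|h t] //= nret /mem_split [a [b ab]] ev.
  by apply: nret; exists h, a, e, b; rewrite ab.
have [f [e /mem_split [s1 [s2 es]] [fe fne]]] := GL _ GLs.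
by exists s1, e, s2, f.
Qed.

End Walks.

(** * Ideals in Leavitt path algebras *)

(* Scalars act through a plain function, as [nuRingType] carries no module
   structure; [leavitt_ind] says that [R] is generated by the family. *)
Record leavitt_structure (K : fieldType) (E : graph) (R : nuRingType) :=
  LeavittStructure {
  scale_of : K -> R -> R;
  vertex_of : vertex E -> R;
  edge_of : edge E -> R;
  ghost_of : edge E -> R;
  scDr : forall a, {morph scale_of a : x y / x + y};
  scDl : forall x, {morph scale_of^~ x : a b / a + b};
  sc1 : forall x, scale_of 1 x = x;
  scA : forall a b x, scale_of a (scale_of b x) = scale_of (a * b) x;
  scMl : forall a x y, scale_of a x ** y = scale_of a (x ** y);
  scMr : forall a x y, x ** scale_of a y = scale_of a (x ** y);
  vxM : forall u v,
    vertex_of u ** vertex_of v = if u == v then vertex_of u else 0;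
  vx_ed_src : forall e, vertex_of (src e) ** edge_of e = edge_of e;
  ed_vx_rng : forall e, edge_of e ** vertex_of (rng e) = edge_of e;
  vx_gh_rng : forall e, vertex_of (rng e) ** ghost_of e = ghost_of e;
  gh_vx_src : forall e, ghost_of e ** vertex_of (src e) = ghost_of e;
  gh_ed : forall e f,
    ghost_of e ** edge_of f = if e == f then vertex_of (rng e) else 0;
  vx_regular : forall v, regular v ->
    vertex_of v = \sum_(e \in out_edges v) edge_of e ** ghost_of e;
  leavitt_ind : forall P : R -> Prop,
    P 0 -> (forall x y, P x -> P y -> P (x + y)) ->
    (forall a v, P (scale_of a (vertex_of v))) ->
    (forall x e, P x -> P (x ** edge_of e)) ->
    (forall x e, P x -> P (x ** ghost_of e)) -> forall x, P x
}.

Section LeavittStructure.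
Variables (K : fieldType) (E : graph) (R : nuRingType).
Variable S : leavitt_structure K E R.
Local Notation sc := (scale_of S).
Local Notation vx := (vertex_of S).
Local Notation ed := (edge_of S).
Local Notation gh := (ghost_of S).
Implicit Types (a b : K) (x y : R) (u v w : vertex E) (e f : edge E).
Implicit Types (s t : seq (edge E)).

Lemma sc0r a : sc a 0 = 0.
Proof. by apply: (addIr (sc a 0)); rewrite -scDr !add0r. Qed.

Lemma sc0l x : sc 0 x = 0.
Proof. by apply: (addIr (sc 0 x)); rewrite -scDl !add0r. Qed.

Lemma sum_scl (I : Type) (r : seq I) (P : pred I) (F : I -> K) x :
  \sum_(i <- r | P i) sc (F i) x = sc (\sum_(i <- r | P i) F i) x.
Proof. by rewrite (big_morph (fun a => sc a x) (scDl S x) (sc0l x)). Qed.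

Lemma vx_ed u e : vx u ** ed e = if u == src e then ed e else 0.
Proof.
rewrite -[in LHS](vx_ed_src S) numulA vxM.
by case: eqP => [->|_]; rewrite ?vx_ed_src ?numul0r.
Qed.

Lemma gh_vx e u : gh e ** vx u = if src e == u then gh e else 0.
Proof.
rewrite -[in LHS](gh_vx_src S) -numulA vxM.
by case: eqP => _; rewrite ?gh_vx_src ?numulr0.
Qed.

(** The argument [v] matters only for the empty list; a nonempty product is the edge product
    followed by its final vertex. *)
Fixpoint mon v s := if s is e :: s' then ed e ** mon (rng e) s' else vx v.

Fixpoint star v s := if s is e :: s' then star (rng e) s' ** gh e else vx v.

Lemma vx_mon u v s : is_walk v s ->
  vx u ** mon v s = if u == v then mon v s else 0.
Proof.
case: s => [_|e s /= /andP[/eqP <- _]]; first by rewrite vxM; case: eqP => // ->.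
by rewrite numulA vx_ed; case: eqP => // _; rewrite numul0r.
Qed.

Lemma mon_vx u v s : is_walk v s ->
  mon v s ** vx u = if walk_end v s == u then mon v s else 0.
Proof.
elim: s v => [v _|e s IH v /= /andP[_ sw]]; first by rewrite vxM.
by rewrite -numulA IH // -/(walk_end _ _); case: ifP => // _; rewrite numulr0.
Qed.

Lemma star_vx u v s : is_walk v s ->
  star v s ** vx u = if v == u then star v s else 0.
Proof.
case: s => [_|e s /= /andP[/eqP <- _]]; first by rewrite vxM.
by rewrite -numulA gh_vx; case: ifP => // _; rewrite numulr0.
Qed.

Lemma mon_cat v s1 s2 : is_walk v s1 -> is_walk (walk_end v s1) s2 ->
  mon v (s1 ++ s2) = mon v s1 ** mon (walk_end v s1) s2.
Proof.
elim: s1 v => [v _ /= sw|e s1 IH v /= /andP[_ sw1] sw2].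
  by rewrite vx_mon // eqxx.
by rewrite IH // numulA.
Qed.

(** The adjacent factors come from the first edges of [s] and [t]; by [gh_ed] they cancel if equal
    and give zero otherwise. As [t] is at least as long as [s], no ghost edge survives. *)
Lemma star_mon u v s t : is_walk u s -> is_walk v t -> (size s <= size t)%N ->
  star u s ** mon v t =
  if (u == v) && (take (size s) t == s)
  then mon (walk_end u s) (drop (size s) t) else 0.
Proof.
elim: s u v t => [|e s IH] u v t.
  move=> _ tw _; rewrite /= vx_mon // take0 drop0 andbT.
  by case: eqP => // ->.
case: t => // f t /= /andP[/eqP <- sw] /andP[/eqP <- tw] st.
rewrite -numulA [gh e ** _]numulA gh_ed eqseq_cons.
move: tw; case: (eqVneq e f) => [<-|_] tw; last by rewrite numul0r numulr0 andbF.
by rewrite vx_mon // eqxx IH // !eqxx.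
Qed.

(** * Compressing combinations of real paths *)

Section Ideal.
Variables (J : set R) (Jideal : ideal_closed J).

Let JMl x y : J y -> J (x ** y). Proof. by case: Jideal => _ _ + _; apply. Qed.
Let JMr x y : J x -> J (x ** y). Proof. by case: Jideal => _ _ _; apply. Qed.

(* An exit of the closed walk [q] gives a walk [g] from [v] that is not a
   prefix of [q ++ g], so that compressing by [g] kills the term [q] and turns
   each remaining term into a closed walk again, or kills it. *)
Lemma ideal_vertex_of_closed_walks v a (l : seq (K * seq (edge E))) :
  condition_L E -> a != 0 ->
  (forall c, c \in l -> [/\ c.2 <> [::], is_walk v c.2 & walk_end v c.2 = v]) ->
  J (sc a (vx v) + \sum_(c <- l) sc c.1 (mon v c.2)) ->
  exists w, J (vx w).
Proof.
move=> EL a0; have [n] := ubnP (size l).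
elim: n v l => // n IH v [|[k q] l] /= le_ln lP Jx.
  (* No closed walk is left, and dividing by [a] puts the vertex itself into [J]. *)
  exists v; move: Jx; rewrite big_nil addr0 => /(JMl (sc a^-1 (vx v))).
  by rewrite scMl scMr scA vxM eqxx mulVf // sc1.
have [/= q0 qw qe] := lP _ (mem_head _ _).
have [p1 [e [p2 [f [qE fe fne]]]]] := exit_of_closed_walk EL q0 qw qe.
pose g := rcons p1 f; pose r := rng f.
have gw : is_walk v g.
  move: qw; rewrite qE is_walk_cat /g -cats1 is_walk_cat /= fe.
  by case/andP=> -> /andP[-> _].
have ge : walk_end v g = r by rewrite /g -cats1 walk_end_cat.
(* At index [size p1], [q] has the edge [e] where [g] has the exit [f]. *)
have gq : take (size g) (q ++ g) == g = false.
  apply/eqP=> /(congr1 (nth e ^~ (size p1))); rewrite qE -catA size_rcons.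
  by rewrite nth_take // nth_cat nth_rcons ltnn subnn eqxx => /esym.
pose l' := [seq (c.1, drop (size g) (c.2 ++ g)) |
            c <- l & take (size g) (c.2 ++ g) == g].
apply: (IH r l').
- rewrite size_map size_filter; apply: leq_ltn_trans (count_size _ _) _.
  by move: le_ln; rewrite ltnS.
- move=> c1 /mapP[c]; rewrite mem_filter => /andP[/eqP cg cl] -> /=.
  have [|c0 cw ce] := lP c; first by rewrite inE cl orbT.
  (* A surviving [c.2 ++ g] is [g] followed by the remainder, which therefore leads from [r] back to
     [r] and is as long as [c.2]. *)
  have cgE := cat_take_drop (size g) (c.2 ++ g); rewrite cg in cgE.
  split.
  + move/(congr1 size); rewrite size_drop size_cat addnK /= => /size0nil.
    exact: c0.
  + have : is_walk v (c.2 ++ g) by rewrite is_walk_cat cw ce.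
    by rewrite -{1}cgE is_walk_cat ge => /andP[].
  + by rewrite -ge -walk_end_cat cgE walk_end_cat ce ge.
have -> : sc a (vx r) + \sum_(c <- l') sc c.1 (mon r c.2) =
  star v g ** (sc a (vx v) + \sum_(c <- (k, q) :: l) sc c.1 (mon v c.2)) ** mon v g.
  rewrite numulDr numulDl scMr star_vx // eqxx scMl star_mon //.
  rewrite eqxx take_size drop_size eqxx ge /=; congr (_ + _).
  rewrite numul_sumr numul_suml big_map big_filter [LHS]big_mkcond /=.
  have E1 c : c \in (k, q) :: l -> star v g ** sc c.1 (mon v c.2) ** mon v g =
      if take (size g) (c.2 ++ g) == g
      then sc c.1 (mon r (drop (size g) (c.2 ++ g))) else 0.
    move=> /lP[_ cw ce]; rewrite scMr scMl -numulA.
    have -> : mon v c.2 ** mon v g = mon v (c.2 ++ g) by rewrite mon_cat // ce.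
    rewrite star_mon ?is_walk_cat ?cw ?ce ?size_cat ?leq_addl // eqxx ge /=.
    by case: ifP => // _; rewrite sc0r.
  rewrite big_cons E1 ?mem_head //= gq add0r; apply: eq_big_seq => c cl.
  by rewrite E1 // inE cl orbT.
exact/JMr/JMl.
Qed.

(* The factor [mon v t] lets one cancel an edge at an infinite emitter without
   knowing that real paths are linearly independent in [R]. *)
Lemma real_combination_eq0 v t (l : seq (K * (vertex E * seq (edge E)))) :
  condition_L E -> ~ (exists w, J (vx w)) -> is_walk v t ->
  (forall c, c \in l -> is_walk c.2.1 c.2.2 /\ walk_end c.2.1 c.2.2 = v) ->
  J ((\sum_(c <- l) sc c.1 (mon c.2.1 c.2.2)) ** mon v t) ->
  \sum_(c <- l) sc c.1 (mon c.2.1 c.2.2) = 0.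
Proof.
move=> EL Jvx tw; have [n] := ubnP (size l).
elim: n l => // n IH l le_ln lP Jl.
have [->|l0] := eqVneq l [::]; first by rewrite big_nil.
have [[k [u s]] ml lmin] := exists_minimum (fun c => size c.2.2) (elimN eqP l0).
have /= [sw se] := lP _ ml.
rewrite (bigID (fun c => c.2 == (u, s))) /= -[X in _ + X]big_filter.
rewrite (bigID (fun c => c.2 == (u, s))) /= -[X in _ + X]big_filter in Jl.
have us : \sum_(c <- l | c.2 == (u, s)) sc c.1 (mon c.2.1 c.2.2) =
    sc (\sum_(c <- l | c.2 == (u, s)) c.1) (mon u s).
  by rewrite -sum_scl; apply: eq_bigr => c /eqP ->.
rewrite us in Jl *; set a := \sum_(c <- l | _) c.1 in us Jl *.
(* The terms with the chosen path may cancel; the others then form a shorter list. *)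
have [a0|a0] := eqVneq a 0.
  rewrite a0 sc0l add0r in Jl *; apply: IH Jl.
    rewrite size_filter ltnS in le_ln *; apply: leq_trans le_ln.
    rewrite -(count_predC (fun c => c.2 == (u, s))) -[X in (X < _)%N]add0n ltn_add2r.
    by rewrite -has_count; apply/hasP; exists (k, (u, s)) => /=.
  by move=> c; rewrite mem_filter => /andP[_]; apply: lP.
(* For nonzero [a], compression by [g] leaves [a] times the vertex [r] plus closed walks at [r],
   which forces a vertex into [J]. *)
case: Jvx; pose g := s ++ t; pose r := walk_end v t.
have gw : is_walk u g by rewrite is_walk_cat sw se.
have ge : walk_end u g = r by rewrite walk_end_cat se.
pose l' := [seq (c.1, drop (size g) (c.2.2 ++ t)) | c <- l &
  (c.2 != (u, s)) && ((u == c.2.1) && (take (size g) (c.2.2 ++ t) == g))].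
apply: (@ideal_vertex_of_closed_walks r a l') => //.
  move=> c1 /mapP[[k1 [u1 s1]]]; rewrite mem_filter => /andP[/= + cl] -> /=.
  case/and3P=> ne /eqP uu /eqP cg; subst u1.
  have /= [cw ce] := lP _ cl; have /= le_s := lmin _ cl.
  have cgE := cat_take_drop (size g) (s1 ++ t); rewrite cg in cgE.
  split.
  (* If the remainder were empty, minimality of [s] would make [s1] as long as [s], hence equal to
     it, and that case is filtered out. *)
  - move/(congr1 size); rewrite size_drop !size_cat subnDr /= => /eqP.
    rewrite subn_eq0 => s1s; case/eqP: ne.
    have ss : size s1 = size s by apply/eqP; rewrite eqn_leq s1s le_s.
    move/eqP: cg; rewrite take_oversize ?size_cat ?ss // eqseq_cat //.
    by case/andP=> /eqP ->.
  - have : is_walk u (s1 ++ t) by rewrite is_walk_cat cw ce.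
    by rewrite -{1}cgE is_walk_cat ge => /andP[].
  - by rewrite -ge -walk_end_cat cgE walk_end_cat ce.
move: Jl => /(JMl (star u g)); rewrite numulDl numulDr scMl scMr.
have -> : mon u s ** mon v t = mon u g by rewrite mon_cat // se.
rewrite star_mon // !eqxx take_size eqxx drop_size ge /=.
congr (J (_ + _)); rewrite numul_suml numul_sumr big_map [LHS]big_filter.
rewrite [RHS]big_filter [LHS]big_mkcond [RHS]big_mkcond.
apply: eq_big_seq => -[k1 [u1 s1]] /= cl; case: ifP => //= _.
have /= [cw ce] := lP _ cl; have /= le_s := lmin _ cl.
rewrite scMl scMr; have -> : mon u1 s1 ** mon v t = mon u1 (s1 ++ t).
  by rewrite mon_cat // ce.
have le_g : (size g <= size (s1 ++ t))%N by rewrite !size_cat leq_add2r.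
have cgw : is_walk u1 (s1 ++ t) by rewrite is_walk_cat cw ce.
rewrite star_mon // ge.
by case: ifP => // _; rewrite sc0r.
Qed.

End Ideal.

(** * The filtration of [R] by upper bounds on ghost length *)

Inductive ghost_degree (n : nat) : R -> Prop :=
| ghost_degree0 : ghost_degree n 0
| ghost_degreeD x y :
    ghost_degree n x -> ghost_degree n y -> ghost_degree n (x + y)
| ghost_degreeU a v s w t :
    is_walk v s -> is_walk w t -> (size t <= n)%N ->
    ghost_degree n (sc a (mon v s ** star w t)).

Lemma ghost_degreeW m n x : (m <= n)%N -> ghost_degree m x -> ghost_degree n x.
Proof.
move=> le_mn; elim=> [|y z _ Hy _ Hz|a v s w t sw tw le_tm].
- exact: ghost_degree0.
- exact: ghost_degreeD.
- by apply: ghost_degreeU => //; apply: leq_trans le_mn.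
Qed.

(** The ghost factor next to [ed e] cancels or gives zero, which lowers the ghost length. A monomial
    without ghost edges absorbs [e] into its real part, so the bound [n.-1] also holds for
    [n = 0]. *)
Lemma ghost_degree_ed n x e : ghost_degree n x -> ghost_degree n.-1 (x ** ed e).
Proof.
elim=> [|y z _ Hy _ Hz|a v s w t sw tw le_tn].
- by rewrite numul0r; apply: ghost_degree0.
- by rewrite numulDl; apply: ghost_degreeD.
rewrite scMl -numulA; case: t tw le_tn => [_ _|f t /= /andP[/eqP fw tw] le_tn].
  rewrite /= vx_ed; case: eqP => _; last first.
    by rewrite numulr0 sc0r; apply: ghost_degree0.
  rewrite -(vx_ed_src S) numulA mon_vx //; case: eqP => se; last first.
    by rewrite numul0r sc0r; apply: ghost_degree0.
  have -> : mon v s ** ed e = mon v (s ++ [:: e]) ** star (rng e) [::].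
    rewrite mon_cat ?se /= ?eqxx // -!numulA; congr (_ ** _).
    by rewrite !(ed_vx_rng, numulA).
  by apply: ghost_degreeU; rewrite // is_walk_cat sw se /= eqxx.
rewrite -numulA gh_ed; case: eqP => _; last first.
  by rewrite !numulr0 sc0r; apply: ghost_degree0.
rewrite star_vx // eqxx; apply: ghost_degreeU => //.
by case: (n) le_tn.
Qed.

Lemma ghost_degree_gh n x e : ghost_degree n x -> ghost_degree n.+1 (x ** gh e).
Proof.
elim=> [|y z _ Hy _ Hz|a v s w t sw tw le_tn].
- by rewrite numul0r; apply: ghost_degree0.
- by rewrite numulDl; apply: ghost_degreeD.
rewrite scMl -numulA -(vx_gh_rng S) [star w t ** _]numulA star_vx //.
case: eqP => [we|_]; last by rewrite numul0r numulr0 sc0r; apply: ghost_degree0.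
have etw : is_walk (src e) (e :: t) by rewrite /= eqxx -we.
by rewrite we; apply: (@ghost_degreeU n.+1 a v s (src e) (e :: t)).
Qed.

Lemma exists_ghost_degree x : exists n, ghost_degree n x.
Proof.
move: x; apply: (@leavitt_ind _ _ _ S (fun x => exists n, ghost_degree n x))
  => [|x y [n Hx] [m Hy]|a v|x e [n Hx]|x e [n Hx]].
- by exists 0%N; apply: ghost_degree0.
- exists (maxn n m); apply: ghost_degreeD.
    exact: ghost_degreeW (leq_maxl _ _) Hx.
  exact: ghost_degreeW (leq_maxr _ _) Hy.
- exists 0%N; have -> : vx v = mon v [::] ** star v [::] by rewrite /= vxM eqxx.
  exact: ghost_degreeU.
- by exists n.-1; apply: ghost_degree_ed.
- by exists n.+1; apply: ghost_degree_gh.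
Qed.

(** Finite sums of vertices are local right units. Allowing every larger list [F'] lets the lists of
    two summands be merged. *)
Lemma sum_numul_vx x : exists F : seq (vertex E), forall F', uniq F' ->
  {subset F <= F'} -> x = \sum_(v <- F') x ** vx v.
Proof.
have [n] := exists_ghost_degree x.
elim=> [|y z _ [F HF] _ [F1 HF1]|a v s w t sw tw _].
- by exists [::] => F' _ _; rewrite big1 // => v _; rewrite numul0r.
- exists (F ++ F1) => F' uF sF.
  under eq_bigr => v _ do rewrite numulDl.
  rewrite big_split -HF -?HF1 // => v vF; apply: sF; rewrite mem_cat vF ?orbT //.
exists [:: w] => F' uF sF; rewrite (bigD1_seq w) ?sF ?mem_head //=.
rewrite big1 ?addr0 => [|u /negPf uw]; rewrite scMl -numulA star_vx //.
  by rewrite eqxx.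
by rewrite eq_sym uw numulr0 sc0r.
Qed.

(* [l] collects the terms of [x ** vx v] without ghost edges and [F] the last
   edges of the other terms, whose sum is [y]. *)
Lemma ghost_degree_decomposition n x v : ghost_degree n x ->
  exists (l : seq (K * (vertex E * seq (edge E)))) y (F : seq (edge E)),
  [/\ x ** vx v = \sum_(c <- l) sc c.1 (mon c.2.1 c.2.2) + y,
      forall c, c \in l -> is_walk c.2.1 c.2.2 /\ walk_end c.2.1 c.2.2 = v,
      y ** vx v = y,
      forall F', uniq F' -> {subset F <= F'} ->
        y = \sum_(e <- F') y ** ed e ** gh e &
      n = 0%N -> y = 0].
Proof.
elim=> [|x1 x2 _ [l1 [y1 [F1 [E1 W1 V1 S1 Z1]]]] _ [l2 [y2 [F2 [E2 W2 V2 S2 Z2]]]]|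
        a u s w t sw tw le_tn].
- exists [::], 0, [::]; split=> // [||F' _ _]; rewrite ?numul0r ?big_nil ?addr0 //.
  by rewrite big1 // => e _; rewrite !numul0r.
- exists (l1 ++ l2), (y1 + y2), (F1 ++ F2); split.
  + by rewrite numulDl E1 E2 big_cat /= addrACA.
  + by move=> c; rewrite mem_cat => /orP[/W1|/W2].
  + by rewrite numulDl V1 V2.
  + move=> F' uF sF; under eq_bigr => e _ do rewrite !numulDl.
    by rewrite big_split -S1 -?S2 // => e eF; apply: sF; rewrite mem_cat eF ?orbT.
  + by move=> n0; rewrite Z1 // Z2 // addr0.
rewrite scMl -numulA star_vx //; case: eqP => [wv|_]; last first.
  exists [::], 0, [::]; split=> // [||F' _ _];
    rewrite ?numulr0 ?numul0r ?sc0r ?big_nil ?addr0 //.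
  by rewrite big1 // => e _; rewrite !numul0r.
case: t tw le_tn => [_ _|f t /= /andP[/eqP fw tw] le_tn] /=.
  rewrite mon_vx //; exists (if walk_end u s == w then [:: (a, (u, s))] else [::]), 0, [::].
  split=> // [|c||F' _ _]; rewrite ?numul0r ?addr0 //.
  - by case: eqP => _; rewrite ?big_seq1 // big_nil sc0r.
  - by case: eqP => // sew; rewrite inE => /eqP -> /=; rewrite sew.
  - by rewrite big1 // => e _; rewrite !numul0r.
exists [::], (sc a (mon u s ** (star (rng f) t ** gh f))), [:: f].
split=> // [||F' uF sF|n0]; rewrite ?big_nil ?add0r //.
- by rewrite scMl -!numulA gh_vx fw wv eqxx.
(* Only the edge [f] contributes, and [gh f ** ed f ** gh f] is [gh f]. *)
- rewrite (bigD1_seq f) ?sF ?mem_head //= big1 => [|e /negPf ne].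
    rewrite addr0 !scMl -!numulA; congr (sc a (_ ** _)).
    rewrite [gh f ** _]numulA gh_ed eqxx numulA star_vx // eqxx //.
  by rewrite !scMl -!numulA [gh f ** _]numulA gh_ed eq_sym ne numul0r !numulr0 sc0r.
- by rewrite n0 in le_tn.
Qed.

(** * Ideals without vertices *)

Section VertexFreeIdeal.
Variables (J : set R) (Jideal : ideal_closed J).
Hypotheses (EL : condition_L E) (Jvx : ~ exists w, J (vx w)).

(** Induction on ghost length: each [x ** ed e] is zero by induction. At a regular vertex
    [vx_regular] then kills [x ** vx v]; at a singular vertex the real part is first isolated and
    shown to vanish. *)
Lemma vertex_free_ideal_eq0 x : J x -> x = 0.
Proof.
have [J0 JB JMl JMr] := Jideal.
have [n] := exists_ghost_degree x; elim: n x => [|n IH] x xn Jx.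
  (* Without ghost edges, [x ** vx v] is a combination of real paths in [J]. *)
  have xv v : x ** vx v = 0.
    have [l [y [F [xE lP _ _ y0]]]] := ghost_degree_decomposition v xn.
    rewrite y0 // addr0 in xE; rewrite xE.
    apply: (@real_combination_eq0 _ Jideal v [::] l) => //.
    by rewrite -xE /=; exact/JMr/JMr.
  have [F /(_ (undup F) (undup_uniq _)) ->] := sum_numul_vx x.
    by rewrite big1.
  by move=> v; rewrite mem_undup.
have xed e : x ** ed e = 0 by apply: IH; [apply: (ghost_degree_ed e xn)|exact/JMr].
have xv v : x ** vx v = 0.
  have [rv|nrv] := pselect (regular v).
    rewrite (vx_regular S rv) fsbig_finite; last by apply: contrapT; case: rv.
    by rewrite numul_sumr big1 // => e _; rewrite numulA xed numul0r.
  have [l [y [F [xE lP yv yE _]]]] := ghost_degree_decomposition v xn.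
  have yed e : src e <> v -> y ** ed e = 0.
    move=> ev; rewrite -yv -numulA vx_ed; case: eqP => [/esym //|_].
    by rewrite numulr0.
  have l0 : \sum_(c <- l) sc c.1 (mon c.2.1 c.2.2) = 0.
    (* At a sink every summand of [y] vanishes, since no edge starts there. *)
    have [sv|nsv] := pselect (sink v).
      apply: (@real_combination_eq0 _ Jideal v [::] l) => //.
      suff y0 : y = 0 by rewrite y0 addr0 in xE; rewrite -xE; exact/JMr/JMr.
      rewrite (yE (undup F)) ?undup_uniq //; last by move=> e; rewrite mem_undup.
      rewrite big1 // => e _; rewrite yed ?numul0r // => ev.
      by have : out_edges v e by []; rewrite sv.
    (* Here [v] is an infinite emitter, so some edge [f] at [v] avoids the finite list [F].
       Multiplication by [ed f] kills [y] and leaves only the real part. *)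
    have [f /= fv fF] : exists2 f, src f = v & f \notin F.
      apply: contrapT => nf; apply: nrv; split=> //; apply.
      apply: (sub_finite_set _ (finite_seq F)) => f /= fv.
      by apply: contrapT => /negP fF; apply: nf; exists f.
    have fw : is_walk v [:: f] by rewrite /= fv eqxx.
    apply: (real_combination_eq0 Jideal EL Jvx fw lP).
    have -> : mon v [:: f] = ed f by rewrite /= ed_vx_rng.
    have yf : y ** ed f = 0.
      rewrite (yE (undup F)) ?undup_uniq //; last by move=> e; rewrite mem_undup.
      rewrite numul_suml big1_seq // => e; rewrite mem_undup /= => eF.
      rewrite -numulA gh_ed; case: eqP eF fF => [->|_ _ _]; first by move=> ->.
      by rewrite numulr0.
    have := congr1 (fun z => z ** ed f) xE; rewrite numulDl yf addr0 => <-.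
    exact/JMr/JMr.
  rewrite xE l0 add0r (yE (undup F)) ?undup_uniq //; last first.
    by move=> e; rewrite mem_undup.
  rewrite big1 // => e _; suff -> : y ** ed e = 0 by rewrite numul0r.
  (* With the real part gone, [y] is [x ** vx v], so [y ** ed e] vanishes along with [x ** ed e]. *)
  have <- : x ** vx v = y by rewrite xE l0 add0r.
  rewrite -numulA vx_ed; case: eqP => _; first exact: xed.
  by rewrite numulr0.
have [F /(_ (undup F) (undup_uniq _)) ->] := sum_numul_vx x.
  by rewrite big1.
by move=> v; rewrite mem_undup.
Qed.

End VertexFreeIdeal.

(** * Sufficiency of the two conditions *)

Lemma leavitt_structure_simple : condition_L E ->
  (forall H : set (vertex E), hereditary H -> saturated H ->
     H = set0 \/ H = setT) ->
  simple_ring R.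
Proof.
move=> EL EH J Jideal; have [J0 JB JMl JMr] := Jideal.
have JD x y : J x -> J y -> J (x + y).
  by move=> Jx Jy; rewrite -[y]opprK -[- y]add0r; apply: (JB) => //; apply: JB.
have [[w Jw]|Jvx] := pselect (exists w, J (vx w)); last first.
  left; apply/seteqP; split=> [x|_ -> //].
  exact: (vertex_free_ideal_eq0 Jideal EL Jvx).
right; apply/seteqP; split=> // x _.
have [||H0|HT] := EH [set v | J (vx v)].
- move=> e /= Je; have -> : vx (rng e) = gh e ** vx (src e) ** ed e.
    by rewrite gh_vx_src gh_ed eqxx.
  exact/JMr/JMl.
(* Saturation: [vx v] is the sum of the products [ed e ** vx (rng e) ** gh e]. *)
- move=> v rv /= Jv; rewrite (vx_regular S rv) fsbig_finite; last first.
    by apply: contrapT; case: rv.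
  rewrite big_seq; apply: big_ind => // e.
  rewrite in_fset_set; last by apply: contrapT; case: rv.
  rewrite inE => /= /Jv Je.
  by rewrite -(ed_vx_rng S) -numulA; apply/JMl/JMr.
- by have : [set v | J (vx v)] w by []; rewrite H0.
have [F /(_ (undup F) (undup_uniq _)) ->] := sum_numul_vx x; last first.
  by move=> v; rewrite mem_undup.
apply: big_ind => // v _; apply/JMl.
by have : [set: vertex E] v by []; rewrite -HT.
Qed.

End LeavittStructure.

(** * The quotient of the path algebra *)

Section PathAlgebraTheory.
Variables (K : fieldType) (G : graph).
Local Notation A := (path_alg K G).
Implicit Types (x y z : A) (p q : gpath G) (u v : vertex G) (d : edge G).

Lemma numulUU a b p q :
  (<< a *g p >> : A) ** << b *g q >> = (a * b) *: path_prod K p q.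
Proof. exact: path_alg_mulUU. Qed.

Lemma scaleU c p : c *: (<< p >> : A) = << c *g p >>.
Proof. by rewrite path_algZU mulr1. Qed.

Lemma numul_pathE p q (pq : prng p = psrc q) :
  (<< p >> : A) ** << q >> = << path_cat pq >>.
Proof. by rewrite numulUU mulr1 scale1r (path_prodE _ pq). Qed.

Lemma numul_path0 p q : prng p <> psrc q -> (<< p >> : A) ** << q >> = 0.
Proof. by move=> pq; rewrite numulUU path_prod0 // scaler0. Qed.

Lemma numulZl c x y : (c *: x) ** y = c *: (x ** y).
Proof.
rewrite [LHS](path_alg_mulEw (msuppZ_le _ _) (fsubset_refl _)).
rewrite [in RHS]/numul /= /path_alg_mul scaler_sumr; apply: eq_bigr => p _.
rewrite scaler_sumr; apply: eq_bigr => q _.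
by rewrite mcoeffZ scalerA mulrA.
Qed.

Lemma numulZr c x y : x ** (c *: y) = c *: (x ** y).
Proof.
rewrite [LHS](path_alg_mulEw (fsubset_refl _) (msuppZ_le _ _)).
rewrite [in RHS]/numul /= /path_alg_mul scaler_sumr; apply: eq_bigr => p _.
rewrite scaler_sumr; apply: eq_bigr => q _.
by rewrite mcoeffZ scalerA mulrCA.
Qed.

Local Notation "[ 'v' u ]" := (<< vertex_path u >> : A) (at level 0).
Local Notation "[ 'e' d ]" := (<< edge_path d >> : A) (at level 0).

Lemma vertex_pathM u v : [v u] ** [v v] = if u == v then [v u] else 0.
Proof.
case: eqP => [uv|uv]; last by rewrite numul_path0.
rewrite (numul_pathE (uv : prng (vertex_path u) = psrc (vertex_path v))).
by congr (<< _ >>); apply: val_inj.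
Qed.

Lemma vertex_edge_path d : [v (src d)] ** [e d] = [e d].
Proof.
rewrite (numul_pathE (erefl : prng (vertex_path (src d)) = psrc (edge_path d))).
by congr (<< _ >>); apply: val_inj.
Qed.

Lemma edge_vertex_path d : [e d] ** [v (rng d)] = [e d].
Proof.
rewrite (numul_pathE (erefl : prng (edge_path d) = psrc (vertex_path (rng d)))).
by congr (<< _ >>); apply: val_inj.
Qed.

(** Paths are built up by their last edge, to match the clause [leavitt_ind]. *)
Lemma path_alg_right_ind (P : A -> Prop) :
  P 0 -> (forall x y, P x -> P y -> P (x + y)) ->
  (forall a u, P (a *: [v u])) -> (forall x d, P x -> P (x ** [e d])) ->
  forall x, P x.
Proof.
move=> P0 PD Pv Pe; elim/path_alg_ind => // a [[u s] sw].
elim/last_ind: s sw => [|s d IH] sw.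
  rewrite (_ : GPath sw = vertex_path u); first by rewrite -scaleU; apply: Pv.
  exact: val_inj.
have : is_walk u (rcons s d) by [].
rewrite -[X in is_walk _ X]cats1 is_walk_cat /= andbT => /andP[uw /eqP sd].
have sp : prng (@GPath _ (u, s) uw) = psrc (edge_path d) by rewrite /prng /= -sd.
rewrite (_ : GPath sw = path_cat sp); last by apply: val_inj; rewrite /= cats1.
by rewrite -scaleU -numul_pathE -numulZl scaleU; apply/Pe/IH.
Qed.

Lemma path_alg_left_unit x : exists u : A, u ** x = x.
Proof.
suff [F HF] : exists F : seq (vertex G), forall F', uniq F' ->
    {subset F <= F'} -> (\sum_(u <- F') [v u]) ** x = x.
  exists (\sum_(u <- undup F) [v u]); apply: HF; first exact: undup_uniq.
  by move=> u; rewrite mem_undup.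
elim/path_alg_right_ind: x => [|x y [F HF] [F1 HF1]|a u|x d [F HF]].
- by exists [::] => F' _ _; rewrite numulr0.
- exists (F ++ F1) => F' uF sF.
  by rewrite numulDr HF ?HF1 // => u uF'; apply: sF; rewrite mem_cat uF' ?orbT.
- exists [:: u] => F' uF sF; rewrite numul_suml (bigD1_seq u) ?sF ?mem_head //=.
  rewrite numulZr vertex_pathM eqxx big1 ?addr0 // => w /negPf wu.
  by rewrite numulZr vertex_pathM wu scaler0.
- by exists F => F' uF sF; rewrite numulA HF.
Qed.

(** With [u] a left unit of [x], [c *: x] is [(c *: u) ** x]. This makes scalar multiplication
    descend to the quotient. *)
Lemma path_alg_idealZ (I : set A) c x : ideal_closed I -> I x -> I (c *: x).
Proof.
case=> _ _ Il _ Ix; have [u <-] := path_alg_left_unit x.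
by rewrite -numulZl; apply: Il.
Qed.

End PathAlgebraTheory.

(** * The Leavitt path algebra as a [leavitt_structure] *)

Section LeavittIsStructure.
Variables (K : fieldType) (E : graph).
Local Notation A := (path_alg K (double_graph E)).
Local Notation I := (ideal_gen (@leavitt_rel K E)).

Definition leavitt_pi (x : A) : leavitt K E := \pi_(nuquot I) x.

Lemma leavitt_pi_surj (x : leavitt K E) : exists y, x = leavitt_pi y.
Proof. by exists (repr x); rewrite /leavitt_pi reprK. Qed.

Lemma leavitt_piP x y : leavitt_pi x = leavitt_pi y <-> ideal_set I (x - y).
Proof. exact: nuquot_piP. Qed.

Lemma leavitt_piD x y : leavitt_pi (x + y) = leavitt_pi x + leavitt_pi y.
Proof. exact: raddfD. Qed.

Lemma leavitt_pi0 : leavitt_pi 0 = 0.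
Proof. exact: raddf0. Qed.

Lemma leavitt_piM x y : leavitt_pi (x ** y) = leavitt_pi x ** leavitt_pi y.
Proof. exact: nuquot_piM. Qed.

Lemma leavitt_pi_eq0 x : leavitt_rel x -> leavitt_pi x = 0.
Proof.
move=> rx; rewrite -leavitt_pi0; apply/leavitt_piP; rewrite subr0.
by move=> J [_]; apply.
Qed.

Definition leavitt_scale (c : K) (x : leavitt K E) : leavitt K E :=
  leavitt_pi (c *: repr x).

Lemma leavitt_scaleE c x : leavitt_scale c (leavitt_pi x) = leavitt_pi (c *: x).
Proof.
apply/leavitt_piP; rewrite -scalerBr.
apply: (@path_alg_idealZ _ _ (ideal_set I) c _ (idealP I)).
by apply/leavitt_piP; rewrite /leavitt_pi reprK.
Qed.

Definition leavitt_vertex v : leavitt K E := leavitt_pi (gen_vertex K v).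
Definition leavitt_edge e : leavitt K E := leavitt_pi (gen_edge K e).
Definition leavitt_ghost e : leavitt K E := leavitt_pi (gen_ghost K e).

Lemma leavitt_scaleDr c : {morph leavitt_scale c : x y / x + y}.
Proof.
move=> x y; have [x' ->] := leavitt_pi_surj x; have [y' ->] := leavitt_pi_surj y.
by rewrite -leavitt_piD !leavitt_scaleE scalerDr leavitt_piD.
Qed.

Lemma leavitt_scaleDl x : {morph leavitt_scale^~ x : a b / a + b}.
Proof.
move=> a b /=; have [x' ->] := leavitt_pi_surj x.
by rewrite !leavitt_scaleE scalerDl leavitt_piD.
Qed.

Lemma leavitt_scale1 x : leavitt_scale 1 x = x.
Proof. by have [y ->] := leavitt_pi_surj x; rewrite leavitt_scaleE scale1r. Qed.

Lemma leavitt_scaleA a b x :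
  leavitt_scale a (leavitt_scale b x) = leavitt_scale (a * b) x.
Proof.
by have [y ->] := leavitt_pi_surj x; rewrite !leavitt_scaleE scalerA.
Qed.

Lemma leavitt_scaleMl a x y :
  leavitt_scale a x ** y = leavitt_scale a (x ** y).
Proof.
have [x' ->] := leavitt_pi_surj x; have [y' ->] := leavitt_pi_surj y.
by rewrite -leavitt_piM !leavitt_scaleE -leavitt_piM numulZl.
Qed.

Lemma leavitt_scaleMr a x y :
  x ** leavitt_scale a y = leavitt_scale a (x ** y).
Proof.
have [x' ->] := leavitt_pi_surj x; have [y' ->] := leavitt_pi_surj y.
by rewrite -leavitt_piM !leavitt_scaleE -leavitt_piM numulZr.
Qed.

Lemma leavitt_vertexM u v :
  leavitt_vertex u ** leavitt_vertex v = if u == v then leavitt_vertex u else 0.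
Proof.
rewrite -leavitt_piM [X in leavitt_pi X]vertex_pathM; case: ifP => // _.
exact: leavitt_pi0.
Qed.

Lemma leavitt_ghost_edge e f :
  leavitt_ghost e ** leavitt_edge f =
  if e == f then leavitt_vertex (rng e) else 0.
Proof.
rewrite -leavitt_piM; case: eqP => [<-|ne].
  (* Subtracting zero turns membership of the difference in the ideal into vanishing of its
     class. *)
  apply/leavitt_piP; rewrite -[_ - _]subr0; apply/leavitt_piP.
  by rewrite leavitt_pi0; apply/leavitt_pi_eq0/LeavittCK1.
exact/leavitt_pi_eq0/LeavittCK1_distinct.
Qed.

Lemma leavitt_vertex_regular v : regular v ->
  leavitt_vertex v =
  \sum_(e \in out_edges v) leavitt_edge e ** leavitt_ghost e.
Proof.
move=> rv; transitivity (leavitt_pi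
    (\sum_(e \in out_edges v) gen_edge K e ** gen_ghost K e)).
  apply/leavitt_piP; rewrite -[_ - _]subr0; apply/leavitt_piP.
  by rewrite leavitt_pi0; apply/leavitt_pi_eq0/LeavittCK2.
have fin : finite_set (out_edges v) by apply: contrapT; case: rv.
rewrite !fsbig_finite // (big_morph _ leavitt_piD leavitt_pi0).
by apply: eq_bigr => e _; rewrite leavitt_piM.
Qed.

Lemma leavitt_right_ind (P : leavitt K E -> Prop) :
  P 0 -> (forall x y, P x -> P y -> P (x + y)) ->
  (forall a v, P (leavitt_scale a (leavitt_vertex v))) ->
  (forall x e, P x -> P (x ** leavitt_edge e)) ->
  (forall x e, P x -> P (x ** leavitt_ghost e)) -> forall x, P x.
Proof.
move=> P0 PD Pv Pe Pg x; have [y ->] := leavitt_pi_surj x.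
elim/path_alg_right_ind: y => [|y z Hy Hz|a v|y [e|e] Hy].
- by rewrite leavitt_pi0.
- by rewrite leavitt_piD; apply: PD.
- by have := Pv a v; rewrite leavitt_scaleE.
- by rewrite leavitt_piM; apply: Pe.
- by rewrite leavitt_piM; apply: Pg.
Qed.

Definition leavitt_is_structure : leavitt_structure K E (leavitt K E).
Proof.
refine (LeavittStructure leavitt_scaleDr leavitt_scaleDl leavitt_scale1
  leavitt_scaleA leavitt_scaleMl leavitt_scaleMr leavitt_vertexM _ _ _ _
  leavitt_ghost_edge leavitt_vertex_regular leavitt_right_ind).
- move=> e; rewrite -leavitt_piM; congr leavitt_pi.
  exact: (@vertex_edge_path K (double_graph E) (inl e)).
- move=> e; rewrite -leavitt_piM; congr leavitt_pi.
  exact: (@edge_vertex_path K (double_graph E) (inl e)).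
- move=> e; rewrite -leavitt_piM; congr leavitt_pi.
  exact: (@vertex_edge_path K (double_graph E) (inr e)).
- move=> e; rewrite -leavitt_piM; congr leavitt_pi.
  exact: (@edge_vertex_path K (double_graph E) (inr e)).
Qed.

End LeavittIsStructure.

(** * Boundary paths *)

Section BoundaryPaths.
Variables (E : graph) (H : set (vertex E)).
Implicit Types (v : vertex E) (e : edge E).

Definition stream := nat -> vertex E * option (edge E).

(* An infinite path is encoded by its consecutive vertices and edges; a finite
   path ending at a singular vertex [w] is padded with the entries [(w, None)]. *)
Definition boundary_path (y : stream) := forall n, ~ H (y n).1 /\
  if (y n).2 is Some e then src e = (y n).1 /\ rng e = (y n.+1).1
  else ~ regular (y n).1 /\ y n.+1 = y n.

Definition stream_tail (y : stream) : stream := fun n => y n.+1.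

Definition stream_cons e (y : stream) : stream :=
  fun n => if n is n'.+1 then y n' else (src e, Some e).

Lemma boundary_path_tail y : boundary_path y -> boundary_path (stream_tail y).
Proof. by move=> yb n; apply: yb. Qed.

Lemma boundary_path_cons e y : hereditary H -> boundary_path y ->
  (y 0%N).1 = rng e -> boundary_path (stream_cons e y).
Proof.
move=> Hh yb ye [|n]; last exact: yb.
by split=> // /Hh /=; rewrite -ye; case: (yb 0%N).
Qed.

Lemma stream_cons_tail y e : boundary_path y -> (y 0%N).2 = Some e ->
  stream_cons e (stream_tail y) = y.
Proof.
move=> yb ye; apply/funext=> -[|n] //=; have [_] := yb 0%N.
by rewrite ye; case: (y 0%N) ye => u o /= -> [->].
Qed.

(** At each vertex choose an edge with range outside [H] if there is one, and stop otherwise.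
    Saturation ensures that the path stops only at singular vertices. *)
Lemma exists_boundary_path v : saturated H -> ~ H v ->
  exists2 y, boundary_path y & (y 0%N).1 = v.
Proof.
move=> Hs Hv.
have /choice [nxt nxtP] : forall u, exists o : option (edge E),
    if o is Some e then src e = u /\ ~ H (rng e)
    else forall e, src e = u -> H (rng e).
  move=> u.
  have [[e eP]|ne] := pselect (exists e, src e = u /\ ~ H (rng e)).
    by exists (Some e).
  exists None => e eu; apply: contrapT => He; apply: ne.
  by exists e.
pose next u := if nxt u is Some e then rng e else u.
pose y n := (iter n next v, nxt (iter n next v)).
have yH n : ~ H (iter n next v).
  elim: n => //= n IH; rewrite {1}/next; have := nxtP (iter n next v).
  by case: (nxt _) => // e [].
exists y => // n; split; first exact: yH.
rewrite /y /=; set u := iter n next v; have Hu : ~ H u by apply: yH.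
rewrite /next; have := nxtP u; case E1 : (nxt u) => [e|] He; first by case: He.
by split; [move=> ru; apply: Hu; apply: Hs | rewrite E1].
Qed.

End BoundaryPaths.

(** * The representation on boundary paths *)

Section BoundaryAction.
Variables (K : fieldType) (E : graph) (H : set (vertex E)) (k : int).
Hypothesis Hh : hereditary H.
Local Notation D := (double_graph E).
Local Notation A := (path_alg K D).
Local Notation state := (stream E * int)%type.
Implicit Types (y z : state) (p q : gpath D) (f g : state -> K).

Definition valid y := boundary_path H y.1.
Definition svertex y : vertex E := (y.1 0%N).1.

(* The letters of the double graph act on states on the right by partial maps,
   and hence on functions of states on the left, see [act].  The real edges
   shift the integer component by [k]. *)
Definition step y (d : edge D) : option state :=
  match d with
  | inl e => if (y.1 0%N).2 == Some e then Some (stream_tail y.1, y.2 + k)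
             else None
  | inr e => if svertex y == rng e then Some (stream_cons e y.1, y.2 - k)
             else None
  end.

Fixpoint run s y : option state :=
  if s is d :: s' then obind (run s') (step y d) else Some y.

(** Validity is tested here instead of being built into the type of states; on invalid states every
    path is undefined. *)
Definition prun p y : option state :=
  if `[< valid y >] && (svertex y == psrc p) then run (pedges p) y else None.

Definition eval p f y : K := oapp f 0 (prun p y).

Definition act (x : A) f y : K := mmap idfun (fun p => eval p f y) x.

Lemma run_cat s1 s2 y : run (s1 ++ s2) y = obind (run s2) (run s1 y).
Proof. by elim: s1 y => //= d s IH y; case: (step y d). Qed.

Lemma step_valid y z d : valid y -> step y d = Some z ->
  valid z /\ svertex z = rng d.
Proof.
move=> yv; case: d => e /=; case: eqP => // ye [<-].
  split; first exact: boundary_path_tail.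
  by have [_] := yv 0%N; rewrite ye => -[].
by split=> //; apply: boundary_path_cons.
Qed.

Lemma run_valid y z s : valid y -> run s y = Some z ->
  valid z /\ svertex z = walk_end (svertex y : vertex D) s.
Proof.
elim: s y => [|d s IH] y yv /=; first by case=> <-.
case E1 : (step y d) => [y'|] //= Ez; have [y'v yd] := step_valid yv E1.
by have := IH _ y'v Ez; rewrite yd.
Qed.

Lemma prun_cat p q (pq : prng p = psrc q) y :
  prun (path_cat pq) y = obind (prun q) (prun p y).
Proof.
rewrite /prun /=; case: ifP => // /andP[/asboolP yv /eqP yp].
rewrite /pedges /= run_cat; case E1 : (run _ y) => [z|] //=.
have [zv zp] := run_valid yv E1.
by rewrite (asboolT zv) zp yp -pq eqxx.
Qed.

Lemma prun_mismatch p q y : prng p <> psrc q -> obind (prun q) (prun p y) = None.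
Proof.
move=> pq; rewrite [prun p y]/prun; case: ifP => // /andP[/asboolP yv /eqP yp].
case E1 : (run _ y) => [z|] //=; have [zv zp] := run_valid yv E1.
by rewrite /prun zp yp -/(prng p) (negPf (introN eqP pq)) andbF.
Qed.

Lemma act_path p f y : act << p >> f y = eval p f y.
Proof. by rewrite /act mmapU mul1r. Qed.

Lemma actB x x' f y : act (x - x') f y = act x f y - act x' f y.
Proof. exact: raddfB. Qed.

Lemma act0 f y : act 0 f y = 0.
Proof. exact: raddf0. Qed.

Lemma actD x x' f y : act (x + x') f y = act x f y + act x' f y.
Proof. exact: raddfD. Qed.

Lemma actZ c x f y : act (c *: x) f y = c * act x f y.
Proof.
rewrite /act (mmapEw (msuppZ_le _ _)) mmapE mulr_sumr.
by apply: eq_bigr => p _; rewrite mcoeffZ mulrA.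
Qed.

Lemma act_prod p q f y : act (path_prod K p q) f y = eval p (eval q f) y.
Proof.
have [pq|/eqP pq] := eqVneq (prng p) (psrc q); rewrite /eval.
  rewrite (path_prodE _ pq) act_path /eval prun_cat.
  by case: (prun p y) => //= z; rewrite /eval.
rewrite path_prod0 // act0; have := prun_mismatch y pq.
by case: (prun p y) => //= z ->.
Qed.

Lemma actM (x x' : A) f y : act (x ** x') f y = act x (act x' f) y.
Proof.
rewrite [x ** x']/numul /= /path_alg_mul.
rewrite (big_morph (fun x => act x f y) (fun a b => actD a b f y) (act0 f y)).
rewrite [RHS]mmapE; apply: eq_bigr => p _.
rewrite (big_morph (fun x => act x f y) (fun a b => actD a b f y) (act0 f y)).
rewrite [in RHS]/eval [X in _ * oapp X _ _]/act.
case E1 : (prun p y) => [z|] /=.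
  rewrite mmapE mulr_sumr; apply: eq_bigr => q _.
  by rewrite actZ act_prod /eval E1 mulrA.
by rewrite mulr0 big1 // => q _; rewrite actZ act_prod /eval E1 mulr0.
Qed.

Definition act_kernel : set A := [set x | forall f y, act x f y = 0].

Lemma act_kernel_ideal : ideal_closed act_kernel.
Proof.
split=> [f y|x x' Hx Hx' f y|a x Hx f y|a x Hx f y]; first exact: act0.
- by rewrite actB Hx Hx' subrr.
- rewrite actM [LHS]mmapE big1 // => p _.
  by rewrite /eval; case: (prun p y) => [z|] /=; rewrite ?Hx mulr0.
- by rewrite actM.
Qed.

Lemma eval_vertex v f y :
  eval (vertex_path (v : vertex D)) f y =
  if `[< valid y >] && (svertex y == v) then f y else 0.
Proof. by rewrite /eval /prun /=; case: ifP. Qed.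

Lemma eval_edge d f y :
  eval (edge_path (d : edge D)) f y =
  if `[< valid y >] && (svertex y == src d) then oapp f 0 (step y d) else 0.
Proof.
by rewrite /eval /prun /psrc /=; case: ifP => //; case: (step y d).
Qed.

(** Prepending [e] and removing it again is the identity and the shifts by [k] cancel; removing
    another edge is undefined. At a regular vertex, removing and restoring the first edge is the
    identity. *)
Lemma act_kernel_rel x : leavitt_rel x -> act_kernel x.
Proof.
case=> [e|e f ef|v rv] g y.
- rewrite actB [X in X - _]actM [X in X - _]act_path [X in X - _]eval_edge.
  rewrite [X in _ - X]act_path [X in _ - X]eval_vertex.
  case: ifP => [/andP[/asboolP yv /eqP ye]|_]; last by rewrite subrr.
  rewrite /= ye eqxx /= act_path eval_edge.
  have zv : valid (stream_cons e y.1, y.2 - k) by apply: boundary_path_cons.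
  by rewrite (asboolT zv) /svertex /= !eqxx /= subrK -surjective_pairing subrr.
- rewrite actM act_path eval_edge; case: ifP => // /andP[_ /eqP ye].
  rewrite /= ye eqxx /= act_path eval_edge /=; case: ifP => //= _.
  by case: eqP => // -[/ef].
have fin : finite_set (out_edges v) by apply: contrapT; case: rv.
rewrite fsbig_finite //= actB act_path eval_vertex.
rewrite (big_morph (fun x => act x g y) (fun a b => actD a b g y) (act0 g y)).
have esrc e : e \in fset_set (out_edges v) -> src e = v.
  by rewrite in_fset_set // inE.
case: ifP => [/andP[/asboolP yv /eqP yV]|yn]; last first.
  rewrite big_seq big1 ?subrr // => e /esrc ev.
  by rewrite actM act_path eval_edge /= ev yn.
(* A boundary path cannot stop at the regular vertex [v]; only the summand of its first edge [e]
   acts nontrivially. *)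
have := yv 0%N; case Ey : (y.1 0%N).2 => [e|] [_ []]; rewrite -/(svertex y) yV //.
move=> ev erng.
rewrite (bigD1_seq e) ?in_fset_set ?inE ?fset_uniq //= big_seq_cond big1 => [|e'].
  rewrite addr0 actM act_path eval_edge /= yV ev eqxx (asboolT yv) Ey eqxx /=.
  rewrite act_path eval_edge.
  have zv : valid (stream_tail y.1, y.2 + k) by apply: boundary_path_tail.
  rewrite (asboolT zv) /= /svertex /= /stream_tail -erng !eqxx /=.
  by rewrite (stream_cons_tail yv Ey) addrK -surjective_pairing subrr.
move=> /andP[/esrc ev' /negPf ne]; rewrite actM act_path eval_edge /= Ey.
by case: ifP => //= _; case: eqP => // -[ee]; rewrite ee eqxx in ne.
Qed.

End BoundaryAction.

Arguments act_kernel K {E} H k _.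

(** * Consequences of simplicity *)

Section Necessity.
Variables (K : fieldType) (E : graph).
Hypothesis simpleL : simple_ring (leavitt K E).
Local Notation A := (path_alg K (double_graph E)).
Local Notation I := (ideal_set (ideal_gen (@leavitt_rel K E))).

(** The image of [J] in the quotient is an ideal, hence zero or everything. As [J] contains the
    ideal of relations, it is determined by its image. *)
Lemma simple_ideal_dichotomy (J : set A) : ideal_closed J ->
  @leavitt_rel K E `<=` J -> J `<=` I \/ J = setT.
Proof.
move=> Jid relJ; have [J0 JB JMl JMr] := Jid.
have JPi x y : J y -> leavitt_pi x = leavitt_pi y -> J x.
  move=> Jy /leavitt_piP Ixy; rewrite -[x](subrK y) -[y in _ + y]opprK.
  apply: (JB); first by apply: Ixy.
  by rewrite -[- y]add0r; apply: (JB).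
have [|HJ|HJ] := simpleL (I := [set x | exists2 y, J y & x = leavitt_pi y]).
- split=> [|x y [x' Jx ->] [y' Jy ->]|x y [y' Jy ->]|x y [y' Jy ->]].
  + by exists 0 => //; rewrite leavitt_pi0.
  + exists (x' - y'); first exact: JB.
    by apply/esym; rewrite /leavitt_pi raddfB.
  + have [x' ->] := leavitt_pi_surj x; exists (x' ** y'); first exact: JMl.
    by rewrite leavitt_piM.
  + have [x' ->] := leavitt_pi_surj x; exists (y' ** x'); first exact: JMr.
    by rewrite leavitt_piM.
- left=> x Jx; rewrite -[x]subr0; apply/leavitt_piP; rewrite leavitt_pi0.
  have : [set z | exists2 y, J y & z = leavitt_pi y] (leavitt_pi x) by exists x.
  by rewrite HJ.
- right; apply/seteqP; split=> // x _.
  have [y Jy xy] : [set z | exists2 y, J y & z = leavitt_pi y] (leavitt_pi x).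
    by rewrite HJ.
  exact: JPi Jy xy.
Qed.

(* [y] witnesses that the kernel of the first action is proper, so this kernel
   vanishes in [leavitt K E] and lies in every other kernel. *)
Lemma act_kernel_sub H k H' k' v (y : stream E * int) :
  hereditary H -> hereditary H' -> valid H y -> svertex y = v ->
  act_kernel K H k `<=` act_kernel K H' k'.
Proof.
move=> Hh Hh' yv yV.
have [|HI|HT] := simple_ideal_dichotomy (@act_kernel_ideal K E H k Hh).
- exact: act_kernel_rel.
- move=> x /HI; apply; split; first exact: act_kernel_ideal.
  exact: act_kernel_rel.
have : act_kernel K H k (gen_vertex K v) by rewrite HT.
move=> /(_ (fun=> 1) y); rewrite act_path eval_vertex asboolT // yV eqxx /=.
by move/eqP; rewrite oner_eq0.
Qed.

Lemma hereditary0 : hereditary (set0 : set (vertex E)).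
Proof. by []. Qed.

Lemma exists_full_boundary_path v (m : int) :
  exists2 y : stream E * int, valid set0 y & svertex y = v.
Proof.
(* A regular vertex emits an edge, whose range cannot lie in the empty set. *)
have sat0 : saturated (set0 : set (vertex E)).
  by move=> u [nsink _] ue; apply: nsink; apply/seteqP; split=> // e /ue.
have [//|y yb yV] := exists_boundary_path (v := v) sat0.
by exists (y, m).
Qed.

Lemma simple_saturated_hereditary (H : set (vertex E)) :
  hereditary H -> saturated H -> H = set0 \/ H = setT.
Proof.
move=> Hh Hs; have [H0|/existsNP[v Hv]] := pselect (forall v, H v).
  by right; apply/seteqP; split=> // v _; apply: H0.
left; apply/seteqP; split=> // w Hw.
have [y yb yV] := exists_boundary_path Hs Hv.
have [z zv zV] := exists_full_boundary_path w 0.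
have yv : valid H (y, 0 : int) by [].
have Kw : act_kernel K H 0 (gen_vertex K w).
  move=> f x; rewrite act_path eval_vertex.
  case: ifP => // /andP[/asboolP xv /eqP xw].
  by have [+ _] := xv 0%N; rewrite -/(svertex x) xw => /(_ Hw).
(* The vertex [w] of [H] would also act as zero on unrestricted boundary paths, yet it preserves the
   value of the constant function 1 at [z]. *)
have := act_kernel_sub 0 Hh hereditary0 yv yV Kw.
move=> /(_ (fun=> 1) z); rewrite act_path eval_vertex asboolT // zV eqxx /=.
by move/eqP; rewrite oner_eq0.
Qed.

(** * Closed paths without exits *)

Section NoExit.
Variables (p : gpath E).
Hypothesis (pclosed : closed_path p) (noexit : ~ exists f, is_exit p f).
Implicit Type y : stream E.

(** Without exits [e] is the only edge leaving its source, which is thus regular: the boundary path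
    cannot stop and must follow [e]. *)
Lemma noexit_boundary_edge y n e : boundary_path set0 y ->
  e \in pedges p -> (y n).1 = src e -> (y n).2 = Some e.
Proof.
move=> yb ep ye; have out f : src f = src e -> f = e.
  by move=> fe; apply: contrapT => ne; apply: noexit; exists f, e.
have [_] := yb n; case: (y n).2 => [f [fe _]|[nr _]].
  by rewrite (out f) // fe.
case: nr; rewrite ye; split.
  by move=> s0; have : out_edges (src e) e by []; rewrite s0.
apply; apply: (sub_finite_set _ (finite_set1 e)) => f /= /out.
exact.
Qed.

Lemma noexit_next e : e \in pedges p ->
  exists2 f, f \in pedges p & rng e = src f.
Proof.
case: pclosed => p0 pe /mem_split [s1 [s2 sE]].
have := gpathP p; rewrite -/(psrc p) -/(pedges p) sE is_walk_cat /= => /andP[_ /andP[_]].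
case: s2 sE => [|f s2] sE /=; last first.
  by move=> /andP[/eqP fe _]; exists f => //; rewrite mem_cat !inE eqxx !orbT.
(* The last edge of [p] is followed cyclically by the first. *)
move=> _; have er : rng e = psrc p by rewrite -pe /prng sE walk_end_cat.
have := gpathP p; rewrite -/(psrc p) -/(pedges p) er -sE.
by case: (pedges p) p0 => // f s _ /= /andP[/eqP <- _]; exists f; rewrite ?mem_head.
Qed.

Lemma noexit_boundary_uniq y y' e : boundary_path set0 y ->
  boundary_path set0 y' -> e \in pedges p ->
  (y 0%N).1 = src e -> (y' 0%N).1 = src e -> y = y'.
Proof.
move=> yb yb' ep ye ye'; apply/funext=> n.
suff [f fp [yf yf']] : exists2 f, f \in pedges p &
    (y n).1 = src f /\ (y' n).1 = src f.
  have := noexit_boundary_edge yb fp yf; have := noexit_boundary_edge yb' fp yf'.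
  by rewrite [y n]surjective_pairing [y' n]surjective_pairing yf yf' /= => -> ->.
elim: n => [|n [f fp [yf yf']]]; first by exists e.
have [g gp fg] := noexit_next fp; exists g => //.
have [_] := yb n; rewrite (noexit_boundary_edge yb fp yf) => -[_ <-].
by have [_] := yb' n; rewrite (noexit_boundary_edge yb' fp yf') => -[_ <-].
Qed.

Lemma run_noexit s (k m : int) y : {subset s <= pedges p} ->
  is_walk (y 0%N).1 s -> boundary_path set0 y ->
  exists y', run k (map inl s) (y, m) = Some (y', m + k *+ size s).
Proof.
elim: s m y => [|e s IH] m y sp /=; first by exists y; rewrite mulr0n addr0.
case/andP=> /eqP ye sw yb; have ep := sp e (mem_head _ _).
have Ey := noexit_boundary_edge yb ep (esym ye).
rewrite Ey eqxx /=; have [_] := yb 0%N; rewrite Ey => -[_ er].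
have [|||y' ->] := IH (m + k) (stream_tail y).
- by move=> f fs; apply: sp; rewrite inE fs orbT.
- by rewrite /stream_tail -er.
- exact: boundary_path_tail.
by exists y'; rewrite mulrS addrA.
Qed.

Lemma double_walk (v : vertex E) (s : seq (edge E)) :
  is_walk (v : vertex (double_graph E)) (map inl s) = is_walk v s.
Proof. by elim: s v => //= e s IH v; rewrite IH. Qed.

Lemma double_walk_end (v : vertex E) (s : seq (edge E)) :
  walk_end (v : vertex (double_graph E)) (map inl s) = walk_end v s.
Proof. by elim: s v => //= e s IH v; apply: IH. Qed.

Definition double_path : gpath (double_graph E) :=
  @GPath (double_graph E) (psrc p, map inl (pedges p))
    (etrans (double_walk (psrc p) (pedges p)) (gpathP p)).

(** Running along [p] returns to [psrc p], where the boundary path is unique. So the stream is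
    unchanged and only the integer moves. *)
Lemma eval_noexit (k : int) (f : stream E * int -> K) y m :
  boundary_path set0 y -> (y 0%N).1 = psrc p ->
  eval set0 k double_path f (y, m) = f (y, m + k *+ size (pedges p)).
Proof.
move=> yb yp; have yv : valid set0 (y, m) by [].
rewrite /eval /prun asboolT // /svertex /= yp eqxx /pedges /= -/(pedges p).
have pw : is_walk (y 0%N).1 (pedges p) by rewrite yp; apply: (gpathP p).
have [y' Er] := run_noexit k m (fun _ => id) pw yb; rewrite Er /=.
suff -> : y' = y by [].
have [yv' ye'] := run_valid hereditary0 yv Er.
move: ye'; rewrite /svertex /= double_walk_end yp -/(prng p) => ye'.
case: pclosed pw ye' => p0 -> pw ye'.
case Ep : (pedges p) p0 pw => [|e s] //= _ /andP[/eqP ey _].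
apply: (@noexit_boundary_uniq _ _ e); rewrite // ?Ep ?mem_head // ey //.
by rewrite yp.
Qed.

(** The difference of the vertex and [p] acts as zero for shift 0 but not for shift 1, whereas
    [act_kernel_sub] puts the first kernel inside the second. *)
Lemma noexit_absurd : False.
Proof.
pose x : A := gen_vertex K (psrc p) - << double_path >>.
have actx (k : int) f (y : stream E * int) : valid set0 y -> svertex y = psrc p ->
    act set0 k x f y = f y - f (y.1, y.2 + k *+ size (pedges p)).
  case: y => y m yv yp; rewrite actB [X in X - _]act_path [X in _ - X]act_path.
  by rewrite [X in X - _]eval_vertex asboolT // yp eqxx eval_noexit.
have [y yv yp] := exists_full_boundary_path (psrc p) 0.
have x0 : act_kernel K set0 0 x.
  move=> f z; have [[zv zp]|nz] := pselect (valid set0 z /\ svertex z = psrc p).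
    by rewrite actx // mul0rn addr0 -surjective_pairing subrr.
  have zF : `[< valid set0 z >] && (svertex z == psrc p) = false.
    by apply/negP => /andP[/asboolP zv /eqP zp]; apply: nz.
  rewrite actB [X in X - _]act_path [X in _ - X]act_path.
  by rewrite [X in X - _]eval_vertex zF /eval /prun zF subrr.
have := act_kernel_sub 1 hereditary0 hereditary0 yv yp x0.
(* The indicator of the integer [y.2] separates [y] from its shift, since [p] has positive
   length. *)
move=> /(_ (fun z => (z.2 == y.2)%:R) y); rewrite actx //= eqxx.
have -> : (y.2 + 1 *+ size (pedges p) == y.2) = false.
  rewrite -subr_eq0 addrC addKr pnatr_eq0.
  by case: pclosed; case: (pedges p).
by move/eqP; rewrite subr0 oner_eq0.
Qed.

End NoExit.

Lemma simple_condition_L : condition_L E.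
Proof.
move=> p [pclosed _]; apply: contrapT => noexit.
exact: noexit_absurd pclosed noexit.
Qed.

End Necessity.

Theorem theorem3p11 (K : fieldType) (E : graph) :
  simple_ring (leavitt K E) <->
  condition_L E /\
  (forall H : set (vertex E), hereditary H -> saturated H ->
     H = set0 \/ H = setT).
Proof.
split=> [simpleL|[EL EH]].
  split; first exact: simple_condition_L simpleL.
  by move=> H; apply: simple_saturated_hereditary simpleL H.
exact: (leavitt_structure_simple (leavitt_is_structure K E) EL EH).
Qed.
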